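(* Let $\gamma\in\mathbb{R}$, let $x\in[\gamma,\gamma+1]$ and let $\beta_1,\dots,\beta_n\in\mathbb{R}$ be such that $\lim_{m\to\infty}|B[m]|=\infty$, where $B=(\overline{\beta_1,\dots,\beta_n})$, and suppose that the $B$-expansion $d(B;x)$ is eventually periodic. Fix $i\in\{1,\dots,n\}$ and let $y=T^{i-1}(x)$. Suppose $y\neq 0$. Let $\lambda$ be a nontrivial conjugate of $\beta_i$ over $K_i=\mathbb{Q}(\beta_1,\dots,\beta_{i-1},\beta_{i+1},\dots,\beta_n)$ (that is, a root $\lambda\ne\beta_i$ in $\mathbb{C}$ of the minimal polynomial of $\beta_i$ over $K_i$). Suppose that $M_i=B[n]/\beta_i$ is fixed by the conjugate map $K_i(\beta_i)\to K_i(\lambda)$, $\beta_i\mapsto\lambda$. Then $$|\lambda|\le \frac{1}{|M_i\, z(\gamma;y)|}.$$ In particular, if $\gamma=0$ and $y=1$, then $|z(0;1)|=1/\varphi$ where $\varphi=(1+\sqrt5)/2$, and so $$|\lambda|\le\frac{\varphi}{|M_i|}.$$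
   Context: Let $B=(\overline{\beta_1,\dots,\beta_n})$ denote the purely periodic sequence $(\beta_m)_{m\ge1}$ of real numbers with $\beta_{m+n}=\beta_m$ (an alternate base), and $B[m]=\prod_{j=1}^m\beta_j$, $B[0]=1$. For $x\in[\gamma,\gamma+1)$ put $T^0(x)=x$ and, for $m\ge1$, $a_m(x)=\lfloor \beta_m T^{m-1}(x)-\gamma\rfloor$ and $T^m(x)=\beta_mT^{m-1}(x)-a_m(x)\in[\gamma,\gamma+1)$. For $x=\gamma+1$ the same formulas are used, starting from $T^0(\gamma+1)=\gamma+1$, $a_1(\gamma+1)=\lfloor\beta_1(\gamma+1)-\gamma\rfloor$, $T^1(\gamma+1)=\beta_1(\gamma+1)-a_1(\gamma+1)\in[\gamma,\gamma+1)$. The $B$-expansion of $x$ is $d(B;x)=(a_1(x),a_2(x),\dots)$; when $|B[m]|\to\infty$ one has $x=\sum_{m\ge1}a_m(x)/B[m]$. For real $\gamma$ and $y\in[\gamma,\gamma+1]$ with $y\ne0$, $z(\gamma;y)$ denotes the real solution $Z$ of minimal absolute value of the equation $$\frac{|Z|}{1-|Z|}=\left|\frac{2y-(2y-2\gamma-1)Z}{1-Z}\right|.$$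
   Formalization: The first bound is proved under the added assumption that y is also fixed by the conjugate map; without it the bound fails, e.g. n=1, γ=0, β=5+√3, x=y=6/β, λ=5−√3. The golden-ratio bound needs no added assumption. *)

(* Defs.v *)
From mathcomp Require Import all_boot all_order all_algebra.
From mathcomp Require Import complex.
From mathcomp Require Import all_classical all_reals all_analysis.
Set Implicit Arguments.
Unset Strict Implicit.
Unset Printing Implicit Defensive.
Import Order.TTheory GRing.Theory Num.Theory.
Import numFieldNormedType.Exports.
Local Open Scope classical_set_scope.
Local Open Scope ring_scope.
Local Open Scope complex_scope.

(* Bases are sequences beta_1, beta_2, ... represented by beta : nat -> R; the
   value beta 0 is never used. *)

Definition alternate_base (R : realType) (n : nat) (beta : nat -> R) : Prop :=
  forall m, (1 <= m)%N -> beta (m + n)%N = beta m.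

Definition Bprod (R : realType) (beta : nat -> R) (m : nat) : R :=
  \prod_(1 <= j < m.+1) beta j.

(* The same recursion covers both x in [gamma, gamma + 1) and x = gamma + 1. *)
Fixpoint Titer (R : realType) (gamma : R) (beta : nat -> R) (x : R) (m : nat)
    : R :=
  if m is k.+1 then
    beta k.+1 * Titer gamma beta x k
    - (Num.floor (beta k.+1 * Titer gamma beta x k - gamma))%:~R
  else x.

(* a_m(x), meaningful for m >= 1 *)
Definition digit (R : realType) (gamma : R) (beta : nat -> R) (x : R) (m : nat)
    : int :=
  Num.floor (beta m * Titer gamma beta x m.-1 - gamma).

Definition eventually_periodic_expansion (R : realType) (gamma : R)
    (beta : nat -> R) (x : R) : Prop :=
  exists N p : nat, (0 < p)%N /\
    forall m, (N < m)%N ->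
      digit gamma beta x (m + p) = digit gamma beta x m.

(* The equation defining z(gamma; y). The condition `|Z| != 1 excludes the
   values at which a denominator vanishes: since 0^-1 = 0 here, Z = 1 would
   otherwise be a spurious solution. *)
Definition z_equation (R : realType) (gamma y Z : R) : Prop :=
  `|Z| != 1 /\
  `|Z| / (1 - `|Z|) =
    `|(2 * y - (2 * y - 2 * gamma - 1) * Z) / (1 - Z)|.

(* If Z and -Z are both solutions of minimal absolute value, one of them is
   picked; `|zmin gamma y| does not depend on that choice. *)
Definition zmin (R : realType) (gamma y : R) : R :=
  xget 0 [set Z | z_equation gamma y Z /\
                  forall Z', z_equation gamma y Z' -> `|Z| <= `|Z'|].

Definition golden_ratio (R : realType) : R := (1 + Num.sqrt 5) / 2.

(* The subfield generated by A; it contains the prime field, so for F of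
   characteristic 0 it is Q(A). *)
Definition gen_subfield (F : fieldType) (A : set F) : set F :=
  smallest (fun L : set F => divring_closed (mem L)) A.

(* K_i = Q(beta_j | 1 <= j <= n, j != i) *)
Definition K_field (R : realType) (n : nat) (beta : nat -> R) (i : nat)
    : set R :=
  gen_subfield [set beta j | j in [set j | (1 <= j <= n)%N /\ j <> i]].

Definition is_min_poly (F : fieldType) (K : set F) (b : F) (p : {poly F})
    : Prop :=
  [/\ p \is a polyOver (mem K), p \is monic, root p b
    & forall q : {poly F}, q \is a polyOver (mem K) -> q \is monic ->
        root q b -> (size p <= size q)%N].

(* Stating this entails that b is algebraic over K. *)
Definition nontrivial_conjugate (R : realType) (K : set R) (b : R)
    (lambda : R[i]) : Prop :=
  lambda <> b%:C /\
  exists2 p : {poly R}, is_min_poly K b p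
    & root (map_poly (real_complex R) p) lambda.

(* sigma restricts to the conjugate map K(b) -> K(lambda), b |-> lambda, which
   is the K-isomorphism determined by b |-> lambda; the values of sigma outside
   K(b) are irrelevant. *)
Definition conjugate_map (R : realType) (K : set R) (b : R) (lambda : R[i])
    (sigma : R -> R[i]) : Prop :=
  let Kb := gen_subfield (K `|` [set b]) in
  let Kl := gen_subfield ((real_complex R @` K) `|` [set lambda]) in
  [/\ forall u, Kb u -> Kl (sigma u),
      forall u v, Kb u -> Kb v -> sigma (u + v) = sigma u + sigma v,
      forall u v, Kb u -> Kb v -> sigma (u * v) = sigma u * sigma v,
      forall u, K u -> sigma u = u%:C
    & sigma b = lambda].

(* Main.v *)
Require Import Defs.
From HB Require Import structures.
From mathcomp Require Import all_boot all_order all_algebra.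
From mathcomp Require Import complex.
From mathcomp Require Import all_classical all_reals all_analysis.
From mathcomp Require Import ring lra zify.
Import Order.TTheory GRing.Theory Num.Theory.
Import numFieldNormedType.Exports.
Local Open Scope classical_set_scope.
Local Open Scope ring_scope.
Local Open Scope complex_scope.

Set Implicit Arguments.
Unset Strict Implicit.
Unset Printing Implicit Defensive.

(** Write [b] for the base element in question, [q = M lambda], [a = M b] for
    the product over a period, and let [t k] be the remainder after [k] full
    periods, counted from [t 0 = y].  A full period acts on a remainder as an
    affine map [t (k+1) = a (t k) + C k] with [C k] in the field [K] of the
    other base elements ([Titer_block]), so [t k] lies in [K(b)] as soon as the
    expansion is eventually periodic, and the conjugates [s k] of [t k] satisfy
    [s (k+1) = q (s k) + C k] with the same [C k]
    ([conjugate_map_orbit]), and [s 0 = y] when [y] is fixed by the conjugate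
    map.  Subtracting the recursions gives
    [s k - t k = (q - a) * \sum_(j < k) t j * q^(k-1-j)].  As [s] and [t] are
    eventually periodic the left side stays bounded, and [q <> a], so that for
    [|q| > 1] and [w = 1/q] the series [\sum_j t j * w^j] sums to [0].  The
    argument uses only its partial sums along one residue class of indices,
    where [s k - t k] is constant.

    All [t j] with [0 < j] lie within [1/2] of [gamma + 1/2]; comparing the
    vanishing series with a geometric one yields, with [r = |w|],
    [|(2y - (2y - 2 gamma - 1) w) / (1 - w)| <= r / (1 - r)].
    Once squared and cleared of denominators, this inequality is affine in
    [Re w] when [r] is fixed, hence it holds for one of the two real points [r]
    and [- r] of the circle.  At the origin it fails (or is an equality, when
    [y = 0]), so by the intermediate value theorem the equation defining
    [z(gamma; y)] has a solution of absolute value at most [r]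
    ([zmin_norm_le]): [|z(gamma; y)| <= 1 / |M lambda|].  For [|q| <= 1] the
    bound follows from [|z(gamma; y)| < 1].  When [gamma = 0] and [y = 1],
    solving a quadratic equation identifies [|z(0; 1)|] with the inverse of the
    golden ratio. *)

(** * The equation defining z(gamma; y) *)

(** The difference of the two sides of the equation, cleared of denominators:
    it is continuous on the whole line, and on [(-1, 1)] its zeros are the
    solutions. *)
Definition zgap (R : realType) (gamma y Z : R) : R :=
  `|Z| * `|1 - Z| - (1 - `|Z|) * `|2 * y - (2 * y - 2 * gamma - 1) * Z|.

Lemma continuous_zgap (R : realType) (gamma y : R) : continuous (zgap gamma y).
Proof.
move=> Z; rewrite /zgap.
apply: cvgB; apply: cvgM.
- exact: cvg_norm.
- by apply: cvg_norm; apply: cvgB; [exact: cvg_cst|exact: cvg_id].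
- by apply: cvgB; [exact: cvg_cst|exact: cvg_norm].
- apply: cvg_norm; apply: cvgB; first exact: cvg_cst.
  by apply: cvgM; [exact: cvg_cst|exact: cvg_id].
Qed.

(** For [|Z| > 1] the left side of the equation is negative. *)
Lemma z_equation_norm_lt1 (R : realType) (gamma y Z : R) :
  z_equation gamma y Z -> `|Z| < 1.
Proof.
move=> [nZ1 eqZ]; rewrite lt_neqAle nZ1 /= leNgt; apply/negP => ltZ.
have : `|Z| / (1 - `|Z|) < 0.
  by rewrite pmulr_rlt0 ?(lt_trans ltr01)// invr_lt0 subr_lt0.
by rewrite eqZ ltNge normr_ge0.
Qed.

Lemma z_equation_zgap (R : realType) (gamma y Z : R) :
  `|Z| < 1 -> z_equation gamma y Z <-> zgap gamma y Z = 0.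
Proof.
move=> ltZ; rewrite /z_equation /zgap (lt_eqF ltZ).
have pos : 1 - `|Z| != 0 by rewrite gt_eqF // subr_gt0.
have nZ : `|1 - Z| != 0.
  by rewrite normr_eq0 subr_eq0; apply: contraTneq ltZ => <-; rewrite normr1 ltxx.
rewrite normrM normfV; split.
  move=> [_ /eqP]; rewrite eqr_div// => /eqP ->; ring.
by move=> /subr0_eq eqZ; split=> //; apply/eqP; rewrite eqr_div// eqZ mulrC.
Qed.

(** The gap is nonpositive at the origin, so it vanishes somewhere on the
    segment from [0] to [W]. *)
Lemma z_solution_le (R : realType) (gamma y W : R) :
  `|W| < 1 -> 0 <= zgap gamma y W ->
  exists2 Z, z_equation gamma y Z & `|Z| <= `|W|.
Proof.
move=> ltW gW; pose h (t : R) := zgap gamma y (t * W).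
have h0 : h 0 <= 0.
  by rewrite /h /zgap mul0r normr0 mul0r sub0r oppr_le0 subr0 mul1r.
have h1 : 0 <= h 1 by rewrite /h mul1r.
have hcont : continuous h.
  move=> t; have := @continuous_comp R R R (fun t => t * W) (zgap gamma y) t; apply.
    by apply: cvgM; [exact: cvg_id|exact: cvg_cst].
  exact: continuous_zgap.
have [|t] := @IVT R h 0 1 0 ler01 (continuous_subspaceT hcont).
  by rewrite ge_min h0 /= le_max h1 orbT.
rewrite in_itv /= => /andP[t0 t1] ht.
have leZ : `|t * W| <= `|W| by rewrite normrM (ger0_norm t0) ler_piMl.
by exists (t * W) => //; apply/z_equation_zgap => //; exact: le_lt_trans ltW.
Qed.

(** As [Z] tends to [-1] the left side [|Z| / (1 - |Z|)] blows up while the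
    right side stays bounded. *)
Lemma z_equation_solvable (R : realType) (gamma y : R) :
  exists Z, z_equation gamma y Z.
Proof.
pose A := 2 * `|y| + `|2 * y - 2 * gamma - 1|.
have A0 : 0 <= A by rewrite addr_ge0 ?mulr_ge0.
pose e := (2 * (A + 1))^-1.
(* The point [e - 1] is so close to [-1] that [e] times the bound [A] of the
   numerator is at most [1/2]. *)
have eA : e * (2 * (A + 1)) = 1.
  by rewrite mulVf// mulf_neq0 ?pnatr_eq0// gt_eqF// ltr_wpDl.
have e0 : 0 < e by rewrite invr_gt0 mulr_gt0// ltr_wpDl.
have e1 : e <= 1 / 2 by nra.
have [||Z hZ _] := @z_solution_le R gamma y (e - 1); last by exists Z.
  by rewrite ltr0_norm; lra.
rewrite /zgap ltr0_norm; last lra.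
rewrite gtr0_norm; last lra.
have : `|2 * y - (2 * y - 2 * gamma - 1) * (e - 1)| <= A.
  apply: (le_trans (ler_normB _ _)); rewrite /A lerD//.
    by rewrite normrM ger0_norm.
  by rewrite normrM ler_piMr// ltr0_norm; lra.
by move: `|2 * y - _| => v vA; nra.
Qed.

(** The minimum is attained because the solutions inside a disk whose radius is
    that of some solution are a compact set.  This makes the choice in [zmin]
    a genuine one for every [y]. *)
Lemma zmin_spec (R : realType) (gamma y : R) :
  z_equation gamma y (zmin gamma y) /\
  forall Z, z_equation gamma y Z -> `|zmin gamma y| <= `|Z|.
Proof.
rewrite /zmin; set P := [set Z | _].
apply: (@xgetPex R 0 P); rewrite /P /=.
have [W hW] := z_equation_solvable gamma y.
have W1 := z_equation_norm_lt1 hW.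
pose S := `[- `|W|, `|W|] `&` [set Z | zgap gamma y Z = 0].
have [|||Z] := @compact_EVT_min R R Num.norm S.
- exists W; split=> /=; first by rewrite in_itv /= -ler_norml.
  by apply/z_equation_zgap.
- apply: compact_closedI; first exact: segment_compact.
  apply: (@preimage_closed _ _ (zgap gamma y) [set Z | Z = 0]).
    by move=> Z _; exact: continuous_zgap.
  exact: closed_eq.
- by apply: continuous_subspaceT => Z; exact: norm_continuous.
rewrite inE /S /= in_itv /= -ler_norml => -[leZ hZ] minZ; exists Z; split.
  by apply/z_equation_zgap => //; exact: le_lt_trans W1.
move=> Z' hZ'; have [leZ'|/ltW] := leP `|Z'| `|W|; last exact: le_trans.
apply: minZ; rewrite inE; split=> /=; first by rewrite in_itv /= -ler_norml.
by apply/z_equation_zgap => //; exact: z_equation_norm_lt1 hZ'.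
Qed.

Lemma zmin_neq0 (R : realType) (gamma y : R) : y != 0 -> zmin gamma y != 0.
Proof.
have [[_ /eqP hz] _] := zmin_spec gamma y; apply: contra_neq => z0; move: hz.
rewrite z0 normr0 mul0r mulr0 !subr0 divr1 eq_sym normr_eq0 mulf_eq0.
by rewrite pnatr_eq0 /= => /eqP.
Qed.

(** The hypothesis is the squared estimate
    [(1 - r) |2y - (2y - 2 gamma - 1) w| <= r |1 - w|] for a complex [w] of
    absolute value [r] and real part [a].  Being affine in [a], it passes to
    one of the end points [a = r] and [a = - r], which represent real [w]. *)
Lemma zmin_norm_le (R : realType) (gamma y r a : R) :
  0 <= r < 1 -> - r <= a <= r ->
  (1 - r) ^+ 2 * (4 * y ^+ 2 - 4 * y * (2 * y - 2 * gamma - 1) * a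
     + (2 * y - 2 * gamma - 1) ^+ 2 * r ^+ 2) <= r ^+ 2 * (1 - 2 * a + r ^+ 2) ->
  `|zmin gamma y| <= r.
Proof.
move=> /andP[r0 r1] /andP[ra ar]; set c := 2 * y - 2 * gamma - 1 => ineq.
suff [W Wr gW] : exists2 W, `|W| = r & 0 <= zgap gamma y W.
  have [|Z hZ ZW] := z_solution_le _ gW; first by rewrite Wr.
  by have [_ /(_ Z hZ) /le_trans] := zmin_spec gamma y; apply; rewrite -Wr.
have key W : `|W| = r ->
    (1 - r) ^+ 2 * (4 * y ^+ 2 - 4 * y * c * W + c ^+ 2 * r ^+ 2)
      <= r ^+ 2 * (1 - 2 * W + r ^+ 2) -> 0 <= zgap gamma y W.
  move=> Wr; have W2 : W ^+ 2 = r ^+ 2 by rewrite -Wr real_normK// num_real.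
  rewrite /zgap Wr -/c subr_ge0 => ineqW.
  rewrite -(@ler_pXn2r _ 2)// ?nnegrE ?mulr_ge0 ?subr_ge0 ?(ltW r1)//.
  rewrite !exprMn !real_normK ?num_real//.
  have -> : (2 * y - c * W) ^+ 2 = 4 * y ^+ 2 - 4 * y * c * W + c ^+ 2 * r ^+ 2.
    by rewrite -W2; ring.
  by have -> : (1 - W) ^+ 2 = 1 - 2 * W + r ^+ 2 by rewrite -W2; ring.
pose A := r ^+ 2 * (1 + r ^+ 2) - (1 - r) ^+ 2 * (4 * y ^+ 2 + c ^+ 2 * r ^+ 2).
pose B := (1 - r) ^+ 2 * (4 * y * c) - 2 * r ^+ 2.
have {ineq} : 0 <= A + B * a by rewrite /A /B; lra.
have [B0 ineq|B0 ineq] := leP 0 B.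
  exists r; first exact: ger0_norm.
  apply: key; first exact: ger0_norm.
  have : 0 <= A + B * r by nra.
  by rewrite /A /B; lra.
exists (- r); first by rewrite normrN ger0_norm.
apply: key; first by rewrite normrN ger0_norm.
have : 0 <= A + B * - r by nra.
by rewrite /A /B; lra.
Qed.

Lemma golden_ratioE (R : realType) :
  0 < golden_ratio R /\ golden_ratio R ^+ 2 = golden_ratio R + 1.
Proof.
have s5 : Num.sqrt 5 ^+ 2 = 5 :> R by rewrite sqr_sqrtr.
have s0 : 0 <= Num.sqrt 5 :> R by exact: sqrtr_ge0.
by rewrite /golden_ratio; split; [lra|field: s5].
Qed.

(** On [[0, 1)] there is no solution, and for [Z < 0] the equation reads
    [Z^2 = Z + 1]; the root in [(-1, 0)] is [1 - phi = - 1 / phi]. *)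
Lemma zmin_golden (R : realType) : `|zmin 0 1 : R| = 1 / golden_ratio R.
Proof.
have [[nz1 hz] _] := zmin_spec (0 : R) 1; have [p0 p2] := golden_ratioE R.
have ltz := z_equation_norm_lt1 (conj nz1 hz).
have /z_equation_zgap : z_equation 0 1 (zmin 0 1 : R) by [].
move=> /(_ ltz); rewrite /zgap; move: (zmin 0 1) ltz => z ltz.
have := ltz; rewrite ltr_norml => /andP[z1 z2].
rewrite [`|1 - z|]gtr0_norm ?subr_gt0// [`|2 * 1 - _|]gtr0_norm; last lra.
have [z0|z0] := leP 0 z.
  by rewrite ger0_norm// => E; exfalso; nra.
rewrite ltr0_norm// => E.
apply: (canRL (mulfK (lt0r_neq0 p0))).
move: (golden_ratio R) p0 p2 => p p0 p2.
have {}E : z ^+ 2 = z + 1 by lra.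
have : (p + z - 1) * (p - z) = 0 by lra.
move=> /eqP; rewrite mulf_eq0 => /orP[/eqP|/eqP] F; first by nra.
by exfalso; lra.
Qed.

(** * From a vanishing power series to a bound on z(gamma; y) *)

Lemma le_of_geometric_error (R : realType) (X Y D r : R) :
  0 <= r < 1 -> (forall m, exists2 k, (m <= k)%N & X <= Y + D * r ^+ k) ->
  X <= Y.
Proof.
move=> /andP[r0 r1] hk; rewrite leNgt; apply/negP => ltXY.
have cv : (fun k => D * r ^+ k) @ \oo --> 0.
  rewrite -(mulr0 D); apply: cvgM; first exact: cvg_cst.
  by apply: cvg_expr; rewrite ger0_norm.
have d0 : 0 < X - Y by rewrite subr_gt0.
have [m _ hm] := @cvgr0_norm_lt _ _ _ _ _ _ cv _ d0.
have [k mk] := hk m; have := hm k mk; rewrite /= ltr_norml => /andP[_]; lra.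
Qed.

(** The coefficients [t j], [0 < j], are centred at [c / 2]; the centre
    contributes a geometric sum, which multiplication by [1 - w] telescopes. *)
Lemma geometric_decomposition (F : fieldType) (c w : F) (t : nat -> F) k :
  2 * (1 - w) * (\sum_(j < k.+1) t j * w ^+ j) =
  2 * t 0%N * (1 - w) + c * w
  + (1 - w) * (\sum_(j < k) (2 * t j.+1 - c) * w ^+ j.+1) - c * w ^+ k.+1.
Proof.
elim: k => [|k IH].
  by rewrite big_ord_recl !big_ord0 expr0 expr1; ring.
rewrite big_ord_recr mulrDr IH [X in _ = _ + _ * X - _]big_ord_recr /=.
rewrite !exprS; ring.
Qed.

Lemma geometric_sum_le (F : numFieldType) (w : F) (e : nat -> F) k :
  `|w| < 1 -> (forall j, `|e j| <= 1) ->
  (1 - `|w|) * `|\sum_(j < k) e j * w ^+ j.+1| <= `|w|.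
Proof.
move=> w1 he; apply: (@le_trans _ _ (`|w| * (1 - `|w| ^+ k))); last first.
  by rewrite ler_piMr// gerBl exprn_ge0.
elim: k => [|k IH]; first by rewrite big_ord0 normr0 mulr0 expr0 subrr mulr0.
rewrite big_ord_recr /=.
apply: (@le_trans _ _ (`|w| * (1 - `|w| ^+ k) + (1 - `|w|) * `|w| ^+ k.+1)).
  apply: (le_trans (ler_wpM2l _ (ler_normD _ _))); first by rewrite subr_ge0 ltW.
  rewrite mulrDr lerD// ler_wpM2l ?subr_ge0 ?(ltW w1)//.
  by rewrite normrM normrX ler_piMl.
by rewrite exprS le_eqVlt; apply/orP; left; apply/eqP; ring.
Qed.

(** The hypothesis on the sums says that [\sum_j t j * w^j = 0], with an error
    that is controlled along an unbounded set of indices only. *)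
Lemma zmin_le_of_vanishing_sums (R : realType) (gamma : R) (t : nat -> R)
    (w D : R[i]) :
  `|w| < 1 -> (forall k, gamma <= t k.+1 <= gamma + 1) ->
  (forall m, exists2 k, (m <= k)%N &
     \sum_(j < k) (t j)%:C * w ^+ j = D * w ^+ k) ->
  `|zmin gamma (t 0%N)|%:C <= `|w|.
Proof.
move=> w1 ht hsum; set y := t 0%N; pose c := 2 * gamma + 1.
(* This is [2 * y - (2 * y - c) * w], the numerator in the equation for z. *)
pose E := 2 * y%:C * (1 - w) + c%:C * w.
have hE m : exists2 k, (m <= k)%N &
   (1 - `|w|) * `|E| <= `|1 - w| * `|w| + `|2 * (1 - w) * D + c%:C| * `|w| ^+ k.
  have [[|k] mk hk] := hsum m.+1; first by [].
  exists k.+1; first exact: ltnW.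
  have := geometric_decomposition c%:C w (fun j => (t j)%:C) k.
  rewrite hk; set S := \sum_(j < k) _ => hS.
  have -> : E = (2 * (1 - w) * D + c%:C) * w ^+ k.+1 - (1 - w) * S.
    apply: (addIr ((1 - w) * S - c%:C * w ^+ k.+1)).
    by rewrite addrA -hS; ring.
  apply: (le_trans (ler_wpM2l _ (ler_normB _ _))); first by rewrite subr_ge0 ltW.
  rewrite mulrDr addrC; apply: lerD.
    rewrite normrM mulrCA ler_wpM2l//.
    have := @geometric_sum_le _ w (fun j => 2 * (t j.+1)%:C - c%:C) k w1.
    apply=> j.
    have -> : 2 * (t j.+1)%:C - c%:C = (2 * t j.+1 - c)%:C.
      by rewrite rmorphB rmorphM /= rmorph_nat.
    rewrite normc_def /= expr0n /= addr0 sqrtr_sqr lecR ler_norml.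
    by have := ht j; rewrite /c; lra.
  rewrite normrM normrX ler_piMl ?mulr_ge0 ?exprn_ge0//.
(* The real-valued modulus: the limit has to be taken in [R]. *)
pose N (z : R[i]) := Num.sqrt (complex.Re z ^+ 2 + complex.Im z ^+ 2).
have NE z : `|z| = (N z)%:C by exact: normc_def.
have N0 z : 0 <= N z by exact: sqrtr_ge0.
have {}w1 : N w < 1 by rewrite -ltcR -NE.
rewrite NE lecR.
have key : (1 - N w) * N E <= N (1 - w) * N w.
  apply: (@le_of_geometric_error _ _ _ (N (2 * (1 - w) * D + c%:C)) (N w)).
    by rewrite N0.
  move=> m; have [k mk] := hE m; exists k => //.
  by rewrite -lecR rmorphD !rmorphM rmorphXn rmorphB /= -!NE.
have N2 z : N z ^+ 2 = complex.Re z ^+ 2 + complex.Im z ^+ 2.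
  by rewrite /N sqr_sqrtr// addr_ge0 ?sqr_ge0.
have r2 := N2 w.
apply: (@zmin_norm_le _ _ _ _ (complex.Re w)).
- by rewrite N0.
- rewrite -ler_norml -(@ler_pXn2r _ 2)// ?nnegrE//.
  by rewrite real_normK ?num_real// N2 lerDl sqr_ge0.
move: key; rewrite -(@ler_pXn2r _ 2)// ?nnegrE ?mulr_ge0 ?subr_ge0 ?(ltW w1)//.
rewrite !exprMn !(N2 E) !(N2 (1 - w)) [X in _ <= X]mulrC.
rewrite /E; case: (w) r2 => a b /=; simpc => /= -> key.
apply: le_trans (le_trans key _); rewrite /c le_eqVlt; apply/orP; left;
  apply/eqP; ring.
Qed.

(** * Generated subfields *)

Lemma in_mem_set (T : Type) (L : set T) u : (u \in mem L) = `[< L u >].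
Proof. by []. Qed.

Lemma gen_subfield_divring_closed (F : fieldType) (A : set F) :
  divring_closed (mem (gen_subfield A)).
Proof.
split.
- by rewrite in_mem_set; apply/asboolP => L [[+ _ _] _]; move=> /asboolP.
- move=> u v /asboolP hu /asboolP hv; apply/asboolP => L hL.
  have [_ hB _] := hL.1; apply/asboolP; apply: hB; apply/asboolP.
    exact: hu.
  exact: hv.
- move=> u v /asboolP hu /asboolP hv; apply/asboolP => L hL.
  have [_ _ hD] := hL.1; apply/asboolP; apply: hD; apply/asboolP.
    exact: hu.
  exact: hv.
Qed.

(** A collective predicate, so that the closure lemmas for field operations
    apply to membership in a generated subfield. *)
Definition gen_subfield_pred (F : fieldType) (A : set F) : {pred F} :=
  mem (gen_subfield A).

HB.instance Definition _ (F : fieldType) (A : set F) :=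
  GRing.isDivringClosed.Build F (gen_subfield_pred A)
    (@gen_subfield_divring_closed F A).

Lemma in_gen_subfield (F : fieldType) (A : set F) u :
  (u \in gen_subfield_pred A) = (u \in gen_subfield A).
Proof. by []. Qed.

Lemma sub_gen_subfield (F : fieldType) (A : set F) u :
  A u -> u \in gen_subfield_pred A.
Proof. by move=> Au; rewrite in_gen_subfield inE => L [_]; exact. Qed.

(** * Alternate bases and their expansions *)

(** A vanishing product would make all later ones vanish. *)
Lemma Bprod_neq0 (R : realType) (beta : nat -> R) m :
  (fun m => `|Bprod beta m|) @ \oo --> +oo -> Bprod beta m != 0.
Proof.
move=> /cvgryPge /(_ 1) [N _ hN]; apply/eqP => hm.
have := hN (m + N)%N (leq_addl _ _); rewrite /= /Bprod.
rewrite (@big_cat_nat _ _ _ m.+1)//= ?ltnS ?leq_addr//.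
by rewrite -/(Bprod beta m) hm mul0r normr0 leNgt ltr01.
Qed.

Lemma BprodS (R : realType) (beta : nat -> R) m :
  Bprod beta m.+1 = beta m.+1 * Bprod beta m.
Proof. by rewrite /Bprod big_nat_recr//= mulrC. Qed.

Lemma base_neq0 (R : realType) (beta : nat -> R) m :
  (fun m => `|Bprod beta m|) @ \oo --> +oo -> beta m.+1 != 0.
Proof.
by move=> /(Bprod_neq0 m.+1); rewrite BprodS mulf_eq0 negb_or => /andP[].
Qed.

Lemma alternate_baseM (R : realType) n (beta : nat -> R) m k :
  alternate_base n beta -> (0 < m)%N -> beta (m + k * n)%N = beta m.
Proof.
move=> hb m0; elim: k => [|k IH]; first by rewrite mul0n addn0.
by rewrite mulSn addnCA addnC hb ?IH// addn_gt0 m0.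
Qed.

(** Sliding the window by one replaces a factor by one that is equal to it. *)
Lemma prod_window (R : realType) n (beta : nat -> R) i :
  alternate_base n.+1 beta ->
  \prod_(i.+1 <= j < i.+1 + n.+1) beta j = Bprod beta n.+1.
Proof.
move=> hb; elim: i => [|i IH]; first by rewrite add1n.
rewrite -IH [RHS]big_ltn; last by rewrite addnS ltnS leq_addr.
rewrite [(i.+2 + _)%N]addSn big_nat_recr /=; last by rewrite addnS ltnS leq_addr.
by rewrite (hb i.+1 isT) mulrC.
Qed.

Lemma Bprod_period (R : realType) n (beta : nat -> R) k :
  alternate_base n.+1 beta -> Bprod beta (k * n.+1) = Bprod beta n.+1 ^+ k.
Proof.
move=> hb; elim: k => [|k IH]; first by rewrite mul0n /Bprod big_geq.
rewrite exprSr -IH -(prod_window (k * n.+1) hb) mulSn addnC /Bprod -addSn.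
by rewrite (@big_cat_nat _ _ _ (k * n.+1).+1)//= leq_addr.
Qed.

(** Otherwise infinitely many of the products [Bprod] would be equal to [1]. *)
Lemma Bprod_not_root_of_unity (R : realType) n (beta : nat -> R) p :
  alternate_base n.+1 beta -> (fun m => `|Bprod beta m|) @ \oo --> +oo ->
  (0 < p)%N -> Bprod beta n.+1 ^+ p != 1.
Proof.
move=> hb /cvgryPge /(_ 2) [m _ hm] p0; apply/eqP => P1.
have := hm (m * p * n.+1)%N; rewrite /= -mulnA leq_pmulr ?muln_gt0 ?p0//.
move=> /(_ isT); rewrite mulnA Bprod_period// mulnC exprM P1 expr1n normr1.
by rewrite leNgt ltr1n.
Qed.

Lemma Titer_range (R : realType) (gamma : R) beta x m :
  gamma <= Titer gamma beta x m.+1 < gamma + 1.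
Proof.
rewrite /=; set u := _ * _; have := floor_itv (u - gamma).
by rewrite intrD => /andP[]; lra.
Qed.

Lemma Titer_digit (R : realType) (gamma : R) beta x m :
  Titer gamma beta x m.+1 =
  beta m.+1 * Titer gamma beta x m - (digit gamma beta x m.+1)%:~R.
Proof. by []. Qed.

(** Once the digits repeat, the difference of two remainders that are [p * n]
    steps apart gets multiplied by the base elements; a nonzero difference
    would grow like [Bprod], but remainders differ by at most [1]. *)
Lemma Titer_eventually_periodic (R : realType) (gamma x : R) n beta :
  alternate_base n beta ->
  (fun m => `|Bprod beta m|) @ \oo --> +oo ->
  eventually_periodic_expansion gamma beta x ->
  exists N p : nat, (0 < p)%N /\ forall m, (N <= m)%N ->
    Titer gamma beta x (m + p * n)%N = Titer gamma beta x m.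
Proof.
move=> hb hB [N [p [p0 hp]]]; exists N.+1, p; split => // m Nm.
have hdig k j : (N < k)%N ->
    digit gamma beta x (k + j * p)%N = digit gamma beta x k.
  move=> Nk; elim: j => [|j IH]; first by rewrite mul0n addn0.
  by rewrite mulSn addnCA addnC hp ?IH// (leq_trans Nk)// leq_addr.
pose T := Titer gamma beta x; pose d k := T (k + p * n)%N - T k.
have dS k : (N < k)%N -> d k.+1 = beta k.+1 * d k.
  move=> Nk; rewrite /d /T addSn !Titer_digit -addSn.
  by rewrite alternate_baseM// [(p * n)%N]mulnC hdig ?(leq_trans Nk)//; ring.
have dB k : d (m + k)%N * Bprod beta m = Bprod beta (m + k) * d m.
  elim: k => [|k IH]; first by rewrite addn0 mulrC.
  by rewrite addnS dS ?(leq_trans Nm (leq_addr _ _))// BprodS -!mulrA IH.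
have d1 k : `|d (m + k)%N| <= 1.
  case: m Nm {dB} => // m _; rewrite /d /T !addSn ler_norml.
  have := Titer_range gamma beta x (m + k); set u := Titer _ _ _ _.
  have := Titer_range gamma beta x (m + k + p * n); set v := Titer _ _ _ _.
  by lra.
apply/subr0_eq/eqP/negPn/negP => dm0; rewrite -/T -/(d m) in dm0.
have dm : 0 < `|d m| by rewrite normr_gt0.
move: hB => /cvgryPge /(_ ((`|Bprod beta m| + 1) / `|d m|)) [k0 _ hk0].
have := hk0 (m + k0)%N (leq_addl _ _); rewrite /= ler_pdivrMr// -normrM -dB.
rewrite normrM leNgt => /negP; apply; rewrite ltr_pwDr//.
by rewrite ler_piMl.
Qed.

(** Indices strictly between two consecutive occurrences of [i] avoid the
    residue class of [i]. *)
Lemma base_in_K_field (R : realType) n (beta : nat -> R) i j :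
  alternate_base n beta -> (0 < i <= n)%N -> (i < j < i + n)%N ->
  beta j \in gen_subfield_pred [set beta j | j in
    [set j | (1 <= j <= n)%N /\ j <> i]].
Proof.
move=> hb hi hj; apply: sub_gen_subfield; have [jn|nj] := leqP j n.
  by exists j => //=; split; lia.
exists (j - n)%N => /=; first by split; lia.
by rewrite -hb ?subnK//; lia.
Qed.

(** The first step of a block multiplies by [beta i.+1]; the later steps, and
    all the digits, contribute only elements of the subfield. *)
Lemma Titer_block (R : realType) (gamma x : R) n beta i k l :
  alternate_base n beta -> (i < n)%N -> (l < n)%N ->
  Titer gamma beta x (i + k * n + l).+1
    - (\prod_(i.+2 <= j < i.+2 + l) beta j) * beta i.+1
      * Titer gamma beta x (i + k * n)%N
  \in gen_subfield_pred [set beta j | j in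
    [set j | (1 <= j <= n)%N /\ j <> i.+1]].
Proof.
move=> hb hi; elim: l => [_|l IH ln].
  rewrite !addn0 big_geq// mul1r Titer_digit -addSn alternate_baseM//.
  by rewrite addrAC subrr sub0r rpredN rpred_int.
rewrite addnS Titer_digit -[(i + k * n + l).+2]/(i.+2 + k * n + l)%N.
rewrite addnAC alternate_baseM// [(i.+2 + l.+1)%N]addnS.
rewrite big_nat_recr /=; last exact: leq_addr.
set P := \prod_(_ <= _ < _) _ in IH *.
set T1 := Titer _ _ _ _ in IH *; set T0 := Titer _ _ _ _ in IH *.
have -> : beta (i.+2 + l)%N * T1 - (digit gamma beta x (i.+2 + l + k * n))%:~R
   - P * beta (i.+2 + l)%N * beta i.+1 * T0
   = beta (i.+2 + l)%N * (T1 - P * beta i.+1 * T0)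
   - (digit gamma beta x (i.+2 + l + k * n))%:~R by ring.
apply: rpredB; last exact: rpred_int.
apply: rpredM; last by apply: IH; exact: ltnW.
by apply: (base_in_K_field hb); lia.
Qed.

(** * Conjugating the orbit *)

(** Going once around the period gives [t N = a^p * t N + c] with [c] in the
    subfield, which is solved for [t N] as [a^p <> 1]; the recursion then
    propagates membership forwards and, dividing by [a], backwards. *)
Lemma periodic_orbit_in_subfield (F : fieldType) (A : set F) (a : F)
    (t : nat -> F) N p :
  a \in gen_subfield_pred A -> a != 0 -> a ^+ p != 1 ->
  (forall k, t k.+1 - a * t k \in gen_subfield_pred A) ->
  t (N + p)%N = t N -> forall k, t k \in gen_subfield_pred A.
Proof.
move=> aL a0 ap1 tS tp.
have step k m : t (k + m)%N - a ^+ m * t k \in gen_subfield_pred A.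
  elim: m => [|m IH]; first by rewrite addn0 expr0 mul1r subrr rpred0.
  have -> : t (k + m.+1)%N - a ^+ m.+1 * t k =
      (t (k + m).+1 - a * t (k + m)%N) + a * (t (k + m)%N - a ^+ m * t k).
    by rewrite addnS exprS; ring.
  by rewrite rpredD// rpredM.
have tN : t N \in gen_subfield_pred A.
  have := step N p; rewrite tp -[X in X - _]mul1r -mulrBl mulrC => h.
  have d0 : 1 - a ^+ p != 0 by rewrite subr_eq0 eq_sym.
  by rewrite -(mulfK d0 (t N)) rpred_div// rpredB ?rpred1 ?rpredX.
move=> k.
have h : t (N + k)%N \in gen_subfield_pred A.
  by rewrite -(subrK (a ^+ k * t N) (t _)) rpredD// rpredM// rpredX.
have d0 : a ^+ N != 0 by rewrite expf_neq0.
rewrite -(mulfK d0 (t k)) rpred_div ?rpredX// mulrC -rpredN.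
by rewrite -(addKr (t (N + k)%N) (- _)) rpredD ?rpredN// addnC step.
Qed.

(** Both orbits are driven by the same inhomogeneous term, so their difference
    satisfies a linear recursion with inhomogeneous term [(q - a) * t k]. *)
Lemma orbit_difference_sum (F : fieldType) (a q : F) (s t : nat -> F) k :
  q != 0 -> s 0%N = t 0%N ->
  (forall k, s k.+1 - q * s k = t k.+1 - a * t k) ->
  (q - a) * \sum_(j < k) t j * q^-1 ^+ j = q * (s k - t k) * q^-1 ^+ k.
Proof.
move=> q0 st0 hs; elim: k => [|k IH].
  by rewrite big_ord0 st0 subrr !mulr0 mul0r.
rewrite big_ord_recr /= mulrDr IH.
have -> : s k.+1 = q * s k + (t k.+1 - a * t k) by rewrite -hs addrC subrK.
have qw := divff q0; move: q^-1 qw => w qw; rewrite exprS.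
transitivity (q * w * ((s k * q - a * t k) * w ^+ k)); last by ring.
by rewrite qw; ring.
Qed.

(** The inhomogeneous term and [M] are fixed by the conjugate map, hence it
    only replaces [b] by [lambda] in the recursion. *)
Lemma conjugate_map_orbit (R : realType) (A : set R) (b M : R)
    (lambda : R[i]) (sigma : R -> R[i]) (t : nat -> R) :
  conjugate_map (gen_subfield A) b lambda sigma ->
  M \in gen_subfield_pred A ->
  (forall k, t k.+1 - M * b * t k \in gen_subfield_pred A) ->
  (forall k, t k \in gen_subfield_pred (gen_subfield A `|` [set b])) ->
  forall k, sigma (t k.+1) - M%:C * lambda * sigma (t k)
            = (t k.+1)%:C - (M * b)%:C * (t k)%:C.
Proof.
move=> [_ sD sM sK sb] hM htK htL k.
pose L := gen_subfield_pred (gen_subfield A `|` [set b]).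
have KL u : u \in gen_subfield_pred A -> u \in L.
  by move=> /asboolP uK; apply: sub_gen_subfield; left.
have bL : b \in L by apply: sub_gen_subfield; right.
have {}sD u v : u \in L -> v \in L -> sigma (u + v) = sigma u + sigma v.
  by move=> /asboolP uL /asboolP vL; exact: sD.
have {}sM u v : u \in L -> v \in L -> sigma (u * v) = sigma u * sigma v.
  by move=> /asboolP uL /asboolP vL; exact: sM.
have {}sK u : u \in gen_subfield_pred A -> sigma u = u%:C.
  by move=> /asboolP uK; exact: sK.
have ML := KL _ hM.
have tL : t k \in L by exact: htL.
have MbL : M * b \in L by rewrite rpredM.
rewrite -{1}(subrK (M * b * t k) (t k.+1)) sD ?(rpredM MbL)//; last exact: KL.
rewrite (sM _ _ MbL tL) (sM _ _ ML bL) sb (sK _ hM) (sK _ (htK k)) addrK.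
by rewrite rmorphB !rmorphM.
Qed.

(** The bound in product form, for any orbit that satisfies an affine recursion
    over the subfield.  If [|M lambda| <= 1] it reduces to [|z| < 1]; otherwise
    the orbit provides a series vanishing at [1 / (M lambda)]. *)
Lemma conjugate_zmin_le (R : realType) (A : set R) (b M gamma : R)
    (lambda : R[i]) (sigma : R -> R[i]) (t : nat -> R) N p :
  conjugate_map (gen_subfield A) b lambda sigma ->
  M \in gen_subfield_pred A -> lambda <> b%:C -> M * b != 0 ->
  (M * b) ^+ p != 1 -> (0 < p)%N ->
  (forall k, t k.+1 - M * b * t k \in gen_subfield_pred A) ->
  (forall k, (N <= k)%N -> t (k + p)%N = t k) ->
  (forall k, gamma <= t k.+1 <= gamma + 1) ->
  sigma (t 0%N) = (t 0%N)%:C ->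
  `|M * zmin gamma (t 0%N)|%:C * `|lambda| <= 1.
Proof.
move=> hs hM lb Mb0 Mbp p0 htK htp ht s0.
have := Mb0; rewrite mulf_eq0 negb_or => /andP[M0 b0].
rewrite normrM rmorphM /= mulrAC.
have nR (u : R) : `|u|%:C = `|u%:C|.
  by rewrite [RHS]normc_def /= expr0n addr0 sqrtr_sqr.
rewrite [`|M|%:C]nR -normrM; set q := M%:C * lambda.
have z1 : `|zmin gamma (t 0%N)|%:C <= 1 :> R[i].
  by rewrite lecR ltW// (z_equation_norm_lt1 (zmin_spec _ _).1).
have z0 : 0 <= `|zmin gamma (t 0%N)|%:C :> R[i] by rewrite lecR.
have [q1|q1] := real_leP (normr_real q) (real1 _); first by rewrite mulr_ile1.
have q0 : q != 0 by rewrite -normr_gt0 (lt_trans _ q1).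
have qa : q - (M * b)%:C != 0.
  rewrite subr_eq0 rmorphM /=; apply/eqP => /mulfI E; apply/lb/E.
  by apply: contra_neq M0 => -[].
have bL : b \in gen_subfield_pred (gen_subfield A `|` [set b]).
  by apply: sub_gen_subfield; right.
have KL u : u \in gen_subfield_pred A ->
    u \in gen_subfield_pred (gen_subfield A `|` [set b]).
  by move=> /asboolP uK; apply: sub_gen_subfield; left.
have tL k : t k \in gen_subfield_pred (gen_subfield A `|` [set b]).
  apply: (periodic_orbit_in_subfield _ Mb0 Mbp _ (htp N (leqnn N))).
    by rewrite rpredM// KL.
  by move=> j; exact: KL.
have hsig := conjugate_map_orbit hs hM htK tL.
have tN j : t (N + j * p)%N = t N.
  elim: j => [|j IH]; first by rewrite mul0n addn0.
  by rewrite mulSn addnCA addnC htp ?leq_addr.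
(* On the indices [N + j * p] the difference of the two orbits is constant,
   which makes the partial sums a constant multiple of a power of [q^-1]. *)
pose D := q * (sigma (t N) - (t N)%:C) / (q - (M * b)%:C).
have : `|zmin gamma (t 0%N)|%:C <= `|q^-1|.
  apply: (@zmin_le_of_vanishing_sums _ _ _ _ D) => //.
    by rewrite normfV invf_lt1// (lt_trans _ q1).
  move=> m; exists (N + m * p)%N.
    by rewrite (leq_trans (leq_pmulr m p0))// leq_addl.
  apply: (mulfI qa).
  rewrite (@orbit_difference_sum _ (M * b)%:C q (sigma \o t) (fun j => (t j)%:C))//=.
  by rewrite tN mulrA /D mulrCA divff// mulr1.
by rewrite normfV -[X in _ <= X -> _]mul1r ler_pdivlMr 1?mulrC// (lt_trans _ q1).
Qed.

(** * The bound on conjugates *)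

Theorem corollary2p3 (R : realType) (gamma x : R) (n : nat) (beta : nat -> R)
  (hx : gamma <= x <= gamma + 1)
  (hbeta : alternate_base n beta)
  (hB : (fun m => `|Bprod beta m|) @ \oo --> +oo)
  (hper : eventually_periodic_expansion gamma beta x)
  (i : nat) (hi : (1 <= i <= n)%N)
  (y : R) (hy : y = Titer gamma beta x i.-1) (hy0 : y <> 0)
  (lambda : R[i])
  (hlambda : nontrivial_conjugate (K_field n beta i) (beta i) lambda)
  (sigma : R -> R[i])
  (hsigma : conjugate_map (K_field n beta i) (beta i) lambda sigma)
  (M : R) (hM : M = Bprod beta n / beta i)
  (hfixM : sigma M = M%:C) :
  (sigma y = y%:C ->
     `|lambda| <= (1 / `|M * zmin gamma y|)%:C) /\
  (gamma = 0 -> y = 1 ->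
     `|zmin 0 1 : R| = 1 / golden_ratio R /\
     `|lambda| <= (golden_ratio R / `|M|)%:C).
Proof.
case: i hi y hy hy0 hlambda hsigma hM => [//|i] /= hin y hy /eqP hy0 [lb _].
case: n hbeta hin => [//|n] hbeta hin hsigma hM.
have b0 : beta i.+1 != 0 := base_neq0 i hB.
have P0 := Bprod_neq0 n.+1 hB.
have Mb : M * beta i.+1 = Bprod beta n.+1 by rewrite hM divfK.
have M0 : M != 0 by rewrite hM mulf_neq0// invr_eq0.
have ME : M = \prod_(i.+2 <= j < i.+2 + n) beta j.
  apply: (mulIf b0); rewrite Mb -(prod_window i hbeta) big_ltn.
    by rewrite mulrC addnS addSn.
  by rewrite addnS ltnS leq_addr.
set A := [set beta j | j in [set j | (1 <= j <= n.+1)%N /\ j <> i.+1]].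
have MK : M \in gen_subfield_pred A.
  rewrite ME big_nat; apply: rpred_prod => j hj.
  by apply: (base_in_K_field hbeta); lia.
pose t k := Titer gamma beta x (i + k * n.+1).
have ty : t 0%N = y by rewrite /t mul0n addn0 hy.
(* A block is one step with factor [beta i.+1] followed by [n] further ones,
   whose product is [M]. *)
have tK k : t k.+1 - M * beta i.+1 * t k \in gen_subfield_pred A.
  have E : (i + k.+1 * n.+1 = (i + k * n.+1 + n).+1)%N by lia.
  by rewrite /t E ME; exact: Titer_block.
have [N [p [p0 hp]]] := Titer_eventually_periodic hbeta hB hper.
have Mbp : (M * beta i.+1) ^+ p != 1.
  by rewrite Mb; exact: Bprod_not_root_of_unity.
have main : sigma y = y%:C -> `|M * zmin gamma y|%:C * `|lambda| <= 1.
  rewrite -ty; apply: (@conjugate_zmin_le _ A (beta i.+1) _ _ _ _ _ N p) => //.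
  - by rewrite Mb.
  - move=> k Nk; rewrite /t mulnDl addnA hp//.
    by rewrite (leq_trans Nk)// (leq_trans (leq_pmulr k (ltn0Sn n)))// leq_addl.
  - move=> k; rewrite /t mulSn addSn addnS.
    by have /andP[-> /ltW ->] := Titer_range gamma beta x (i + (n + k * n.+1)).
have part1 : sigma y = y%:C -> `|lambda| <= (1 / `|M * zmin gamma y|)%:C.
  move=> /main; rewrite rmorphM fmorphV /= => h.
  rewrite ler_pdivlMr; first by rewrite mulrC.
  by rewrite ltcR normr_gt0 mulf_neq0// zmin_neq0.
split=> // g0 y1; split; first exact: zmin_golden.
have -> : golden_ratio R / `|M| = 1 / `|M * zmin gamma y|.
  by rewrite g0 y1 normrM zmin_golden !mul1r invfM invrK mulrC.
apply: part1; rewrite y1; case: hsigma => _ _ _ + _; apply.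
by apply/asboolP; rewrite -in_mem_set; exact: (rpred1 (gen_subfield_pred A)).
Qed.
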